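(* Let $H$ be an edge-ordered forest (with at least one edge) of order chromatic number $2$. Then $\mathrm{ex}_<(n,H)=n\cdot 2^{O(\sqrt{\log n})}$; that is, there is a constant $C=C(H)$ such that for all integers $n\ge 2$, $$\mathrm{ex}_<(n,H)\le n\cdot 2^{C\sqrt{\log n}}.$$
   Context: An edge-ordered graph is a finite simple graph together with a linear order on its edge set. Isomorphisms of edge-ordered graphs must preserve the edge-order, and a subgraph of an edge-ordered graph inherits the edge-order. An edge-ordered graph $G$ contains an edge-ordered graph $H$ if $H$ is isomorphic (as an edge-ordered graph) to a (not necessarily induced) subgraph of $G$; otherwise $G$ avoids $H$. For an edge-ordered graph $H$ with at least one edge, $\mathrm{ex}_<(n,H)$ is the maximal number of edges in an edge-ordered graph on $n$ vertices that avoids $H$. An edge-ordered forest is an edge-ordered graph whose underlying simple graph is a forest. A vertex $v$ of an edge-ordered graph is close if the edges incident to $v$ form an interval in the edge-order (i.e. they are consecutive in the edge-order). For an edge-ordered forest $H$ with at least one edge, ''order chromatic number $2$'' may be taken to mean: $H$ has a proper $2$-coloring of its vertices such that all vertices in one of the two color classes are close. Here $\log$ is the binary logarithm. *)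

(* Defs.v *)
From HB Require Import structures.
From mathcomp Require Import all_boot all_order all_algebra.
From mathcomp Require Import reals exp.

Set Implicit Arguments.
Unset Strict Implicit.
Unset Printing Implicit Defensive.

Import Order.TTheory GRing.Theory Num.Theory.

(* A pair (E, L): edges are 2-element vertex sets, and L is the graph of a
   (reflexive) linear order relation on E. Encoding the order as a finite set
   of pairs makes the edge-ordered graphs on V a finite type. *)
Definition eograph_axiom (V : finType)
    (D : {set {set V}} * {set {set V} * {set V}}) : bool :=
  let: (E, L) := D in
  [&& [forall e in E, #|e| == 2],
      L \subset setX E E,
      [forall e in E, (e, e) \in L],
      [forall e, forall f, ((e, f) \in L) && ((f, e) \in L) ==> (e == f)],
      [forall e, forall f, forall g,
         ((e, f) \in L) && ((f, g) \in L) ==> ((e, g) \in L)]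
    & [forall e in E, forall f in E, ((e, f) \in L) || ((f, e) \in L)]].

Record eograph (V : finType) := EOGraph {
  eo_data : {set {set V}} * {set {set V} * {set V}};
  _ : eograph_axiom eo_data
}.

HB.instance Definition _ (V : finType) := [isSub for @eo_data V].
HB.instance Definition _ (V : finType) := [Finite of eograph V by <:].

Definition edges (V : finType) (G : eograph V) : {set {set V}} :=
  (eo_data G).1.

Definition edge_le (V : finType) (G : eograph V) : rel {set V} :=
  fun e f => (e, f) \in (eo_data G).2.

Definition adj (V : finType) (G : eograph V) : rel V :=
  fun x y => [set x; y] \in edges G.

(* phi is an isomorphism of edge-ordered graphs from H onto the subgraph of G
   with vertex set phi @: U and edge set { phi @: e | e \in edges H }. *)
Definition embedding (U V : finType) (H : eograph U) (G : eograph V)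
    (phi : {ffun U -> V}) : bool :=
  [&& injectiveb phi,
      [forall e in edges H, phi @: e \in edges G]
    & [forall e in edges H, forall f in edges H,
         edge_le G (phi @: e) (phi @: f) == edge_le H e f]].

Definition contains (U V : finType) (G : eograph V) (H : eograph U) : bool :=
  [exists phi, embedding H G phi].

Definition avoids (U V : finType) (G : eograph V) (H : eograph U) : bool :=
  ~~ contains G H.

(* When H has an edge the maximum ranges over a nonempty family, since the
   edgeless graph avoids H. *)
Definition ex_lt (n : nat) (U : finType) (H : eograph U) : nat :=
  \max_(G : eograph 'I_n | avoids G H) #|edges G|.

Definition is_forest (V : finType) (G : eograph V) : Prop :=
  forall s : seq V, 2 < size s -> ~ ucycle (adj G) s.

Definition close_vertex (V : finType) (G : eograph V) (v : V) : Prop :=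
  forall e f g : {set V},
    e \in edges G -> f \in edges G -> g \in edges G ->
    v \in e -> v \in g -> edge_le G e f -> edge_le G f g -> v \in f.

Definition proper_coloring (V : finType) (T : eqType) (G : eograph V)
    (c : V -> T) : Prop :=
  forall x y : V, adj G x y -> c x != c y.

(* Order chromatic number 2, in the form it takes for edge-ordered forests with
   at least one edge; not meant for other edge-ordered graphs. *)
Definition order_chromatic2 (V : finType) (G : eograph V) : Prop :=
  exists c : V -> bool, proper_coloring G c /\
    exists b : bool, forall v : V, c v = b -> close_vertex G v.

Local Open Scope ring_scope.

Definition log2 (R : realType) (x : R) : R := ln x / ln 2.

(* Main.v *)
Require Import Defs.
From mathcomp Require Import all_boot all_order all_algebra.
From mathcomp Require Import reals exp.
From mathcomp Require Import zify lra.

Set Implicit Arguments.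
Unset Strict Implicit.
Unset Printing Implicit Defensive.

(** Cut the edge order of a graph [G] avoiding [H] into [M] consecutive windows,
    and call a window heavy for a vertex if it holds at least a 1/(4M) fraction
    of the degree of that vertex. Let [k] be the number of vertices of [H].

    If the vertices with at least [k] heavy windows carry total degree more than
    M^O(k) per vertex, then many of them share the same [k] increasing heavy
    windows, and [H] embeds: its close class is sent star by star into the
    windows, in the order of [H], while the other class is sent to these
    vertices. Hence these vertices carry few edges, and about half of all edges
    [e] lie in a window that is heavy for both ends of [e], where each end has
    fewer than [k] heavy windows. The vertex sets of these windows have total
    size at most [k |V(G)|], so recursing into the windows costs a factor O(k) in
    the edge density, while the number of edges drops by the factor [M]. With
    M = 2^s, where s is about sqrt(log n), the recursion depth is O(s), and the
    bound is n O(k)^s M^O(k). *)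

(** * Counting and monotone selection in finite sets *)

Lemma card_cover_le (I T : finType) (X : {set T}) (Y : {set I})
    (F : I -> {set T}) :
    {in X, forall e, exists2 v, v \in Y & e \in F v} ->
  #|X| <= \sum_(v in Y) #|F v|.
Proof.
move=> XF; have: X \subset \bigcup_(v in Y) F v.
  by apply/subsetP => e /XF[v vY eF]; apply/bigcupP; exists v.
move=> /subset_leq_card /leq_trans; apply.
elim/big_rec2: _ => [|v m A _ IH]; first by rewrite cards0.
by apply: leq_trans (leq_card_setU _ _) _; rewrite leq_add2l.
Qed.

Lemma card_nat_range (T : finType) (P : {set T}) (f : T -> nat) (a D : nat) :
    {in P &, injective f} -> {in P, forall x, a <= f x < a + D} ->
  #|P| <= D.
Proof.
move=> f_inj f_range; rewrite -[D](size_iota a) cardE -(size_map f).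
apply: uniq_leq_size.
  rewrite map_inj_in_uniq ?enum_uniq// => u v.
  by rewrite !mem_enum; apply: f_inj.
move=> _ /mapP[u uP ->]; rewrite mem_iota; apply: f_range.
by rewrite -mem_enum.
Qed.

(** Since [lt] is total on [P], the number of predecessors is injective there, so each value below
    [D] is taken at most once. *)
Lemma card_low_rank (T : finType) (P : {set T}) (lt : rel T) (D : nat) :
    irreflexive lt -> transitive lt ->
    {in P &, forall x y, x != y -> lt x y || lt y x} ->
  #|[set x in P | #|[set y in P | lt y x]| < D]| <= D.
Proof.
move=> lt_irr lt_tr lt_tot.
apply: (@card_nat_range _ _ (fun x => #|[set y in P | lt y x]|) 0); last first.
  by move=> x; rewrite inE => /andP[_].
have mono u v : u \in P -> lt u v ->
    #|[set y in P | lt y u]| < #|[set y in P | lt y v]|.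
  move=> uP uv; apply: proper_card; apply/properP; split.
    by apply/subsetP => w; rewrite !inE => /andP[-> /lt_tr]; apply.
  by exists u; rewrite !inE uP ?lt_irr.
move=> u v; rewrite !inE => /andP[uP _] /andP[vP _] E.
apply/eqP; apply: contraT => /(lt_tot _ _ uP vP)/orP[] /mono.
  by move=> /(_ uP); rewrite E ltnn.
by move=> /(_ vP); rewrite E ltnn.
Qed.

(** An element of [L] with [i] predecessors for [q] goes to entry [i] of [P] sorted by [t]. Elements
    with equal [q] share an image, so only strict comparisons are carried over. *)
Lemma increasing_selection (B T : finType) (L : {set B}) (P : {set T})
    (q : B -> nat) (t : T -> nat) (r0 : T) :
    {in P &, injective t} -> #|L| <= #|P| ->
  exists f : B -> T, {in L, forall b, f b \in P} /\
    {in L &, forall b b', q b < q b' -> t (f b) < t (f b')}.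
Proof.
move=> t_inj LP; pose s := sort (relpre t leq) (enum P).
have s_size : size s = #|P| by rewrite size_sort -cardE.
have s_mem r : (r \in s) = (r \in P) by rewrite mem_sort mem_enum.
have s_sorted : sorted (relpre t leq) s.
  by apply: sort_sorted => u v; apply: leq_total.
pose rk b := #|[set b' in L | q b' < q b]|.
have rk_lt b : b \in L -> rk b < size s.
  move=> bL; rewrite s_size; apply: leq_trans LP; apply: proper_card.
  apply/properP; split; first by apply/subsetP => c; rewrite inE => /andP[].
  by exists b; rewrite // !inE ltnn andbF.
exists (fun b => nth r0 s (rk b)); split.
  by move=> b bL; rewrite -s_mem mem_nth ?rk_lt.
move=> b b' bL b'L qbb'.
have rkbb' : rk b < rk b'.
  apply: proper_card; apply/properP; split.
    apply/subsetP => c; rewrite !inE => /andP[-> /=] /ltn_trans; exact.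
  by exists b; rewrite !inE bL ?ltnn.
have tr : transitive (relpre t leq) by move=> ? ? ?; apply: leq_trans.
have := sorted_ltn_nth tr r0 s_sorted (rk b) (rk b').
rewrite !inE !rk_lt// => /(_ isT isT rkbb') /=; rewrite leq_eqVlt.
case/orP => // /eqP /t_inj; rewrite -!s_mem !mem_nth ?rk_lt//.
move=> /(_ isT isT) /eqP; rewrite nth_uniq ?rk_lt ?sort_uniq ?enum_uniq//.
by rewrite ltn_eqF.
Qed.

(** * Embedding a forest star by star into rows *)

(* Induction on [S]: the star of an eliminable [a] is added last. The rows that
   are early or late in their star are discarded before the induction, so that
   the at most one old neighbour of [a] leaves room on both sides in its star. *)
Lemma rows_embed (I B V T : finType) (N : I -> B -> bool)
    (q : I -> B -> nat) (x : I -> T -> V) (y : T -> V) (t : I -> T -> nat)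
    (X : {set V}) (S : {set I}) (R0 : {set T}) :
    (forall S' : {set I}, S' \subset S -> S' != set0 ->
       exists2 a, a \in S' & forall b b', N a b -> N a b' ->
         [exists a1 in S' :\ a, N a1 b] -> [exists a1 in S' :\ a, N a1 b'] ->
         b = b') ->
    (forall a b b', N a b -> N a b' -> q a b = q a b' -> b = b') ->
    (forall a, {in R0, forall r, x a r \in X}) ->
    (forall a, {in R0 &, forall r r', x a r = x a r' -> y r = y r' -> r = r'}) ->
    (forall a, {in R0 &, forall r r',
       x a r = x a r' -> t a r = t a r' -> r = r'}) ->
    #|S| * (4 * #|B| * #|X|) < #|R0| ->
  exists rho : B -> T,
    [/\ forall b, rho b \in R0,
        {in [pred b | [exists a in S, N a b]] &, injective (y \o rho)},
        forall a b b', a \in S -> N a b -> N a b' ->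
          x a (rho b) = x a (rho b')
      & forall a b b', a \in S -> N a b -> N a b' -> q a b < q a b' ->
          t a (rho b) < t a (rho b')].
Proof.
move En : #|S| => n; elim: n S R0 En => [|n IH] S R0.
  move=> /eqP; rewrite cards_eq0 => /eqP-> _ _ _ _ _.
  rewrite mul0n card_gt0 => /set0Pn[r rR].
  exists (fun=> r); split=> // [b b'|a b b']; last by rewrite inE.
  by rewrite inE => /exists_inP[a]; rewrite inE.
move=> Sn elim_S q_inj xX xy_inj xt_inj R0_big.
have S_neq0 : S != set0 by rewrite -card_gt0 Sn.
have [a aS a_elim] := elim_S S (subxx _) S_neq0.
pose lower r := [set r' in R0 | (x a r' == x a r) && (t a r' < t a r)].
pose upper r := [set r' in R0 | (x a r' == x a r) && (t a r < t a r')].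
(* The margin [2 * #|B|] on each side pays for at most [#|B|] rows whose [y] is already taken and
   still leaves [#|B|] rows for the new leaves of [a]. *)
pose R1 := [set r in R0 | (2 * #|B| <= #|lower r|) && (2 * #|B| <= #|upper r|)].
have R1sub : R1 \subset R0 by apply/subsetP => r; rewrite inE => /andP[].
have low_star (lt : rel nat) v : irreflexive lt -> transitive lt ->
    (forall i j, i != j -> lt i j || lt j i) ->
    #|[set r in [set r in R0 | x a r == v] |
        #|[set r' in [set r in R0 | x a r == v] | lt (t a r') (t a r)]|
          < 2 * #|B| ]| <= 2 * #|B|.
  move=> irr tr tot; apply: (@card_low_rank _ _ (relpre (t a) lt)).
  - by move=> r /=.
  - by move=> r1 r2 r3 /=; apply: tr.
  move=> r1 r2; rewrite !inE => /andP[r1R /eqP r1v] /andP[r2R /eqP r2v] r12.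
  apply: tot; apply: contra_neq r12; apply: (xt_inj a) => //.
  by rewrite r1v r2v.
have R1_card : #|R0 :\: R1| <= 4 * #|B| * #|X|.
  rewrite mulnC -sum_nat_const.
  (* The rows discarded from the star with centre [v]: at most [2 * #|B|] at its start and as many
     at its end. *)
  pose F v := [set r in [set r in R0 | x a r == v] |
        #|[set r' in [set r in R0 | x a r == v] | t a r' < t a r]| < 2 * #|B| ]
     :|: [set r in [set r in R0 | x a r == v] |
        #|[set r' in [set r in R0 | x a r == v] | t a r < t a r']| < 2 * #|B| ].
  apply: leq_trans (_ : \sum_(v in X) #|F v| <= _).
    apply: card_cover_le => r; rewrite !inE.
    case/andP => rR1 rR; exists (x a r); first exact: xX.
    rewrite rR /= negb_and -!ltnNge in rR1; rewrite !inE rR eqxx /=.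
    have -> : [set r' in [set r0 in R0 | x a r0 == x a r] | t a r' < t a r]
       = lower r by apply/setP => r'; rewrite !inE andbA.
    have -> : [set r' in [set r0 in R0 | x a r0 == x a r] | t a r < t a r']
       = upper r by apply/setP => r'; rewrite !inE andbA.
    by [].
  apply: leq_sum => v _; apply: leq_trans (leq_card_setU _ _) _.
  rewrite (_ : 4 * #|B| = 2 * #|B| + 2 * #|B|); last by lia.
  apply: leq_add.
    by apply: (low_star ltn) => [i|i j k|i j] /=; rewrite ?ltnn; lia.
  by apply: (low_star (fun i j => ltn j i)) => [i|i j k|i j] /=; lia.
have [|||||||rho1 [rho1R rho1y rho1x rho1t]] := IH (S :\ a) R1.
- by move: Sn; rewrite (cardsD1 a) aS => -[].
- move=> S' S'S; apply: elim_S; apply: subset_trans S'S (subsetDl _ _).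
- by [].
- by move=> i r /(subsetP R1sub); apply: xX.
- by move=> i r r' /(subsetP R1sub) rR /(subsetP R1sub); apply: xy_inj.
- by move=> i r r' /(subsetP R1sub) rR /(subsetP R1sub); apply: xt_inj.
- move: R1_card R0_big; rewrite cardsD (setIidPr R1sub) mulSn.
  by move: (_ * #|X|) => w; lia.
pose D1 : pred B := [pred b | [exists a1 in S :\ a, N a1 b]].
(* The pivot of the star of [a]: the row and the [q]-value of the only neighbour of [a] placed
   before. Without such a neighbour, any row of [R1] and the threshold 0 will do. *)
have [r [th [rR1 old_r]]] : exists r th, r \in R1 /\
    forall b, N a b -> D1 b -> r = rho1 b /\ th = q a b.
  case: (pickP [pred b | N a b && D1 b]) => [b /= /andP[ab bD]|none].
    exists (rho1 b), (q a b); split=> [|b' ab' b'D]; first exact: rho1R.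
    by rewrite (a_elim b b').
  have [b _|no_b] := pickP (@predT B).
    exists (rho1 b), 0; split=> [|b' ab' b'D]; first exact: rho1R.
    by have := none b'; rewrite /= ab' b'D.
  have /set0Pn[r rR] : R1 != set0.
    rewrite -card_gt0; move: R1_card R0_big.
    rewrite cardsD (setIidPr R1sub) mulSn.
    by move: (_ * #|X|) => w; lia.
  by exists r, 0; split=> // b; have := no_b b.
pose used := [set y (rho1 b) | b in D1].
have used_card : #|used| <= #|B| := leq_trans (leq_imset_card _ _) (max_card _).
(* Within one star of [a] the map [y] is injective, so at most [#|B|] of its rows meet [used]. *)
have avail (P : {set T}) : {in P, forall r', r' \in R0 /\ x a r' = x a r} ->
    2 * #|B| <= #|P| -> #|B| <= #|[set r' in P | y r' \notin used]|.
  move=> Pstar PB; pose P' := [set r' in P | y r' \in used].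
  have : #|P'| <= #|used|.
    rewrite -(card_in_imset (f := y)); last first.
      move=> r1 r2; rewrite !inE => /andP[/Pstar[r1R r1x] _].
      by move=> /andP[/Pstar[r2R r2x] _]; apply: (xy_inj a) => //; rewrite r1x.
    by apply/subset_leq_card/subsetP => _ /imsetP[r'] + ->; rewrite inE => /andP[].
  have -> : [set r' in P | y r' \notin used] = P :\: P'.
    by apply/setP => r'; rewrite !inE; case: (r' \in P); case: (y r' \in used).
  have : P' \subset P by apply/subsetP => r'; rewrite inE => /andP[].
  rewrite cardsD => /setIidPr->; lia.
have [rR0 /andP[r_low r_upp]] : r \in R0 /\
    (2 * #|B| <= #|lower r|) && (2 * #|B| <= #|upper r|).
  by move: rR1; rewrite inE => /andP[].
pose P1 := [set r' in lower r | y r' \notin used].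
pose P2 := [set r' in upper r | y r' \notin used].
have P1P r' : r' \in P1 -> [/\ r' \in R0, x a r' = x a r, t a r' < t a r
    & y r' \notin used].
  by rewrite !inE => /andP[/and3P[-> /eqP-> ->] ->].
have P2P r' : r' \in P2 -> [/\ r' \in R0, x a r' = x a r, t a r < t a r'
    & y r' \notin used].
  by rewrite !inE => /andP[/and3P[-> /eqP-> ->] ->].
(* New leaves below the threshold go to rows before the pivot, the others to rows after it. Equality
   with [th] goes to the upper side; it can only occur when the pivot is not the row of an old
   neighbour. *)
pose L1 := [set b | [&& N a b, ~~ D1 b & q a b < th]].
pose L2 := [set b | [&& N a b, ~~ D1 b & th <= q a b]].
have [||f1 [f1P f1_mono]] := @increasing_selection _ _ L1 P1 (q a) (t a) r.
- move=> r1 r2 /P1P[r1R r1x _ _] /P1P[r2R r2x _ _].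
  by apply: (xt_inj a) => //; rewrite r1x.
- apply: leq_trans (max_card _) (avail _ _ r_low) => r'.
  by rewrite inE => /and3P[? /eqP].
have [||f2 [f2P f2_mono]] := @increasing_selection _ _ L2 P2 (q a) (t a) r.
- move=> r1 r2 /P2P[r1R r1x _ _] /P2P[r2R r2x _ _].
  by apply: (xt_inj a) => //; rewrite r1x.
- apply: leq_trans (max_card _) (avail _ _ r_upp) => r'.
  by rewrite inE => /and3P[? /eqP].
(* The last default [r] serves the [b] with no neighbour in [S], which only have to land in [R0]. *)
pose rho b := if D1 b then rho1 b else
  if b \in L1 then f1 b else if b \in L2 then f2 b else r.
have rho_old b : D1 b -> rho b = rho1 b by rewrite /rho => ->.
have rhoP b : N a b -> [\/ [/\ D1 b, rho b = r & q a b = th],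
    [/\ ~~ D1 b, b \in L1, rho b = f1 b & q a b < th]
  | [/\ ~~ D1 b, b \in L2, rho b = f2 b & th <= q a b]].
  move=> ab; rewrite /rho !inE ab /=; case bD: (D1 b) => /=.
    by have [-> ->] := old_r _ ab bD; constructor 1.
  by case: ltnP => qb; [constructor 2|constructor 3].
have rho_star b : N a b -> x a (rho b) = x a r.
  by case/rhoP=> [[_ -> _]|[_ /f1P/P1P[_ xb _ _] -> _]
    |[_ /f2P/P2P[_ xb _ _] -> _]].
have rho_mono b b' : N a b -> N a b' -> q a b < q a b' ->
    t a (rho b) < t a (rho b').
  move=> ab ab'.
  case: (rhoP b ab) => [[_ -> ->]|[_ bL -> qb]|[_ bL -> qb]];
  case: (rhoP b' ab') => [[_ -> qb']|[_ b'L -> qb']|[_ b'L -> qb']] qbb'.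
  - by rewrite qb' ltnn in qbb'.
  - by have := ltn_trans qbb' qb'; rewrite ltnn.
  - by have /P2P[] := f2P _ b'L.
  - by have /P1P[] := f1P _ bL.
  - exact: f1_mono.
  - have /P1P[_ _ lo _] := f1P _ bL; have /P2P[_ _ hi _] := f2P _ b'L.
    exact: ltn_trans lo hi.
  - by have := leq_ltn_trans qb qbb'; rewrite qb' ltnn.
  - by have := leq_ltn_trans qb (ltn_trans qbb' qb'); rewrite ltnn.
  - exact: f2_mono.
have rhoR b : rho b \in R0.
  rewrite /rho; case: ifP => _; first exact: (subsetP R1sub).
  case: ifP => [/f1P/P1P[]//|_]; case: ifP => [/f2P/P2P[]//|_ //].
have rho_new b : N a b -> ~~ D1 b -> y (rho b) \notin used.
  move=> ab bD; case: (rhoP b ab) => [[]|[_ /f1P/P1P[_ _ _ ?] -> _]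
    |[_ /f2P/P2P[_ _ _ ?] -> _]] //.
  by rewrite (negPf bD).
have dom_split b : [exists a in S, N a b] -> ~~ D1 b -> N a b.
  case/exists_inP => a1 a1S a1b; case: (eqVneq a1 a) => [<- //|a1a].
  by case/negP; apply/exists_inP; exists a1; rewrite // !inE a1a.
have in_dom a1 b : a1 \in S -> a1 != a -> N a1 b -> D1 b.
  by move=> a1S a1a a1b; apply/exists_inP; exists a1; rewrite // !inE a1a.
exists rho; split=> // [b b'|a1 b b' a1S|a1 b b' a1S].
- rewrite !inE /= => bS b'S.
  have old_new c c' : D1 c -> ~~ D1 c' -> N a c' -> y (rho c) <> y (rho c').
    move=> cD c'D ac' E; have := rho_new _ ac' c'D; rewrite -E rho_old//.
    by rewrite imset_f.
  case: (boolP (D1 b)) => bD; case: (boolP (D1 b')) => b'D.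
  + by rewrite !rho_old//; apply: rho1y.
  + by move=> E; case: (old_new _ _ bD b'D) => //; apply: dom_split.
  + by move=> E; case: (old_new _ _ b'D bD) => //; apply: dom_split.
  have [ab ab'] := (dom_split _ bS bD, dom_split _ b'S b'D).
  move=> /(xy_inj a _ _ (rhoR _) (rhoR _)).
  rewrite !rho_star// => /(_ erefl) E.
  have [Q|Q|] := ltngtP (q a b) (q a b'); last exact: q_inj.
    by have := rho_mono _ _ ab ab' Q; rewrite E ltnn.
  by have := rho_mono _ _ ab' ab Q; rewrite E ltnn.
- case: (eqVneq a1 a) => [->|a1a] ab ab'; first by rewrite !rho_star.
  rewrite !rho_old ?(in_dom a1)//; apply: rho1x => //.
  by rewrite !inE a1a.
case: (eqVneq a1 a) => [->|a1a] ab ab'; first exact: rho_mono.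
rewrite !rho_old ?(in_dom a1)//; apply: rho1t => //.
by rewrite !inE a1a.
Qed.

(** * Colour coding *)

(** The condition fixes the colours of the [#|J|] vertices in the image of [p] and leaves all others
    free. *)
Lemma card_coloring_fixed (J V : finType) (p : J -> V) : injective p ->
  #|J| ^ #|J| * #|[set chi : {ffun V -> J} | [forall i, chi (p i) == i]]|
    = #|{ffun V -> J}|.
Proof.
move=> p_inj.
pose F v : pred J := [pred i | (v \in codom p) ==> (p i == v)].
have -> : #|[set chi : {ffun V -> J} | [forall i, chi (p i) == i]]|
    = #|(family F : simpl_pred {ffun V -> J})|.
  apply: eq_card => chi; rewrite !inE; apply/forallP/familyP => /=.
    move=> chip v; rewrite inE; apply/implyP => /codomP[i ->].
    by rewrite (eqP (chip i)).
  move=> chiF i; have := chiF (p i).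
  by rewrite inE codom_f /= => /eqP/p_inj->.
rewrite card_family card_ffun.
have -> : foldr muln 1 [seq #|F x| | x : V] = \prod_v #|F v|.
  by rewrite foldrE big_map big_enum.
rewrite (bigID (mem (codom p))) /= big1 ?mul1n; last first.
  move=> v /codomP[i ->]; rewrite -(card1 i); apply: eq_card => j.
  by rewrite !inE codom_f /=; apply/eqP/eqP => [/p_inj|->].
rewrite (eq_bigr (fun=> #|J|)) => [|v vp]; last first.
  by apply: eq_card => j; rewrite !inE (negPf vp).
rewrite prod_nat_const -expnD -(card_codom p_inj); congr (_ ^ _).
exact: cardC.
Qed.

(** Averaging: each row is coloured correctly by a fraction [1 / #|J| ^ #|J|] of all colourings, so
    some colouring is correct on at least that fraction of the rows. It later keeps the images of
    different vertices of [H] apart. *)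
Lemma rainbow_coloring (J V T : finType) (R0 : {set T}) (p : T -> J -> V) :
    J -> {in R0, forall r, injective (p r)} ->
  exists chi : {ffun V -> J},
    #|R0| <= #|J| ^ #|J| * #|[set r in R0 | [forall i, chi (p r i) == i]]|.
Proof.
move=> j0 p_inj; apply/existsP; apply: contraT; rewrite negb_exists.
move=> /forallP/= few; pose good chi r := [forall i, chi (p r i) == i].
have count : \sum_(chi : {ffun V -> J}) #|J| ^ #|J| * #|[set r in R0 | good chi r]|
    = #|R0| * #|{ffun V -> J}|.
  transitivity (\sum_(chi : {ffun V -> J}) \sum_(r in R0)
      #|J| ^ #|J| * good chi r).
    apply: eq_bigr => chi _; rewrite -big_distrr /=; congr (_ * _).
    rewrite -sum1dep_card big_mkcondr /=.
    by apply: eq_bigr => r _; case: (good chi r).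
  rewrite exchange_big /= -sum_nat_const; apply: eq_bigr => r rR.
  rewrite -(card_coloring_fixed (p_inj r rR)) -big_distrr /=; congr (_ * _).
  rewrite -sum1dep_card [RHS]big_mkcond /=.
  by apply: eq_bigr => chi _; rewrite -/(good chi r); case: (good chi r).
have : \sum_(chi : {ffun V -> J}) (#|J| ^ #|J| * #|[set r in R0 | good chi r]|).+1
    <= \sum_(chi : {ffun V -> J}) #|R0|.
  by apply: leq_sum => chi _; rewrite ltnNge; apply: few.
under eq_bigr do rewrite -addn1.
rewrite big_split /= count sum1_card sum_nat_const mulnC.
have : 0 < #|{ffun V -> J}| by apply/card_gt0P; exists [ffun=> j0].
by move: #|{ffun _ -> _}| (#|_| * _) => u w; lia.
Qed.

(** * Edge ranks and incidences in edge-ordered graphs *)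

(** The position in the edge-order, counted from 0; it turns comparisons of edges into comparisons
    of numbers. *)
Definition edge_rank (V : finType) (G : eograph V) (e : {set V}) : nat :=
  #|[set f in edges G | edge_le G f e && (f != e)]|.

Lemma edge_card2 (V : finType) (G : eograph V) (e : {set V}) :
  e \in edges G -> #|e| = 2.
Proof.
rewrite /edges; case: G => -[E L] /= /and5P[/forallP/(_ e)/implyP E2 _ _ _ _].
by move=> /E2/eqP.
Qed.

Lemma edge_rank_lt (V : finType) (G : eograph V) (e f : {set V}) :
  e \in edges G -> f \in edges G -> edge_le G e f -> e != f ->
  edge_rank G e < edge_rank G f.
Proof.
rewrite /edge_rank /edges /edge_le; case: G => -[E L] /= ax eE fE ef nef.
have /and5P[_ _ _ /forallP asym /andP[/forallP tr _]] := ax.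
apply: proper_card; apply/properP; split.
  apply/subsetP => g; rewrite !inE => /and3P[-> ge gne] /=.
  have /forallP/(_ e)/forallP/(_ f)/implyP-> := tr g; last by rewrite ge.
  apply: contraNneq gne => gf; rewrite gf in ge *.
  by have /forallP/(_ f)/implyP := asym e; rewrite ef ge eq_sym; apply.
by exists e; rewrite !inE ?eE ?ef ?nef ?eqxx // !andbF.
Qed.

Lemma edge_leE (V : finType) (G : eograph V) (e f : {set V}) :
  e \in edges G -> f \in edges G ->
  edge_le G e f = (edge_rank G e <= edge_rank G f).
Proof.
move=> eE fE; have [<-|nef] := eqVneq e f.
  rewrite leqnn; move: eE; rewrite /edges /edge_le.
  case: G {f fE} => -[E L] /= /and5P[_ _ /forallP/(_ e)/implyP refl _ _].
  exact: refl.
apply/idP/idP => [ef|]; first exact/ltnW/edge_rank_lt.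
apply: contraLR => nle; rewrite -ltnNge; apply: edge_rank_lt => //; last first.
  by rewrite eq_sym.
move: eE fE nle; rewrite /edges /edge_le; case: G => -[E L] /=.
move=> /and5P[_ _ _ _ /andP[_ /forallP tot]] eE fE.
have /implyP/(_ eE)/forallP/(_ f)/implyP/(_ fE) := tot e.
by case/orP => ->.
Qed.

Lemma edge_rank_inj (V : finType) (G : eograph V) :
  {in edges G &, injective (edge_rank G)}.
Proof.
move=> e f eE fE efr; apply/eqP; apply: contraT => nef.
have := @edge_rank_lt _ G e f eE fE.
by rewrite edge_leE// efr leqnn ltnn => /(_ isT nef).
Qed.

Lemma adj_sym (V : finType) (G : eograph V) : symmetric (adj G).
Proof. by move=> x y; rewrite /adj setUC. Qed.

Lemma adj_neq (V : finType) (G : eograph V) (x y : V) : adj G x y -> x != y.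
Proof. by rewrite /adj => /edge_card2; rewrite cards2; case: eqP. Qed.

Lemma set2_inj (T : finType) (a b c : T) :
  a != b -> [set a; b] = [set a; c] -> b = c.
Proof.
move=> ab /setP/(_ b); rewrite !inE eqxx orbT eq_sym (negPf ab) /=.
by move=> /esym/eqP.
Qed.

Lemma edge_cover (V : finType) (G : eograph V) (v : V) (e : {set V}) :
  e \in edges G -> v \in e -> exists2 x, e = [set v; x] & adj G v x.
Proof.
move=> eE ve; have /eqP/cards2P[a [b [ab eab]]] := edge_card2 eE.
move: ve eE; rewrite eab !inE => /orP[] /eqP-> eE; first by exists b.
by exists a; rewrite 1?setUC // adj_sym.
Qed.

(** * Cycles and an elimination order for forests *)

(** A path in [G] is prolonged at its front, never straight back. It has at most [#|V|] vertices, so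
    at some point the new vertex is already on the path and closes a cycle. *)
Lemma min_degree2_cycle (V : finType) (G : eograph V) (W : {set V}) :
    W != set0 ->
    {in W, forall v u, exists2 w, w \in W & (w != u) && adj G v w} ->
  exists2 s, 2 < size s & ucycle (adj G) s.
Proof.
move=> /set0Pn[v0 v0W] deg2.
have grow n : (exists2 s, 2 < size s & ucycle (adj G) s) \/
    exists x p, [/\ size p = n, path (adj G) x p, uniq (x :: p) & x \in W].
  elim: n => [|n [IH|[x [p [pn xp Up xW]]]]]; [|by left|].
    by right; exists v0, [::].
  (* [head x p] is the second vertex of the path; excluding it makes the cycle longer than 2. On a
     one-vertex path it is [x], which is not its own neighbour anyway. *)
  have [u uW /andP[u_head xu]] := deg2 x xW (head x p).
  have [uxp|uxp] := boolP (u \in x :: p); last first.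
    right; exists u, (x :: p); split=> //=; first by rewrite pn.
      by rewrite adj_sym xu.
    by rewrite uxp.
  left; move: uxp; rewrite inE eq_sym (negPf (adj_neq xu)) /= => up.
  case/path.splitP: {p} up xp Up u_head {pn} => p1 p2.
  rewrite cat_path -cat_cons cat_uniq => /andP[xp _] /andP[Up _] u_head.
  exists (x :: rcons p1 u).
    by case: p1 u_head {xp Up} => [|? ?]; rewrite /= ?size_rcons// eqxx.
  rewrite /ucycle Up andbT /= rcons_path xp last_rcons adj_sym; exact: xu.
have [//|[x [p [pn _ /card_uniqP Up _]]]] := grow #|V|.
by have := max_card (mem (x :: p)); rewrite Up /= pn ltnn.
Qed.

(** Otherwise every [a] in [S] has two neighbours that are shared with other members of [S]. As a
    shared vertex has two neighbours in [S], these vertices together with [S] induce minimum degree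
    2, hence a cycle. *)
Lemma forest_elimination (V : finType) (G : eograph V) (S : {set V}) :
    is_forest G -> S != set0 ->
  exists2 a, a \in S & forall b b', adj G a b -> adj G a b' ->
    [exists a1 in S :\ a, adj G a1 b] -> [exists a1 in S :\ a, adj G a1 b'] ->
    b = b'.
Proof.
move=> forest S0.
pose shared a b := adj G a b && [exists a1 in S :\ a, adj G a1 b].
have [/exists_inP[a aS /forallP aP]|none] := boolP
    [exists a in S, [forall b, forall b', shared a b && shared a b' ==> (b == b')]].
  exists a => // b b' ab ab' sb sb'; apply/eqP.
  by have /forallP/(_ b')/implyP := aP b; apply; rewrite /shared ab ab' sb.
pose W := S :|: [set b | [exists a in S, shared a b]].
have [||s s2 sc] := @min_degree2_cycle _ G W; last by case: (forest s s2).
  by have /set0Pn[a aS] := S0; apply/set0Pn; exists a; rewrite !inE aS.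
move=> v vW u; case: (boolP (v \in S)) => vS.
  move: none; rewrite negb_exists => /forallP/(_ v); rewrite vS /=.
  rewrite negb_forall => /existsP[b]; rewrite negb_forall => /existsP[b'].
  rewrite negb_imply => /andP[/andP[sb sb'] nbb'].
  have inW c : shared v c -> c \in W.
    by move=> sc; rewrite !inE; apply/orP; right; apply/exists_inP; exists v.
  have [E|nbu] := eqVneq b u.
    exists b'; first exact: inW.
    by rewrite -E eq_sym nbb'; case/andP: sb'.
  by exists b; [exact: inW|rewrite nbu; case/andP: sb].
move: vW; rewrite !inE (negPf vS) /= => /exists_inP[a aS].
case/andP => av /exists_inP[a1]; rewrite !inE => /andP[a1a a1S] a1v.
have [E|nau] := eqVneq a u.
  by exists a1; rewrite ?inE ?a1S// -E a1a adj_sym.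
by exists a; rewrite ?inE ?aS// nau adj_sym.
Qed.

(** * The close class of [H] and its order *)

(** Isolated vertices are vacuously close, so they may join the close colour class; then every
    vertex outside [A] has a neighbour in [A]. *)
Lemma close_class (U : finType) (H : eograph U) :
    order_chromatic2 H ->
  exists A : {set U},
    [/\ {in A, forall a, close_vertex H a},
        {in A &, forall a a', ~~ adj H a a'},
        forall e, e \in edges H ->
          exists a b, [/\ a \in A, b \notin A & e = [set a; b]]
      & forall b, b \notin A -> exists2 a, a \in A & adj H a b].
Proof.
case=> c [c_proper [i c_close]].
pose A := [set u | (c u == i) || [forall v, ~~ adj H u v]].
have iso_adj u v : [forall v, ~~ adj H u v] -> adj H u v = false.
  by move=> /forallP/(_ v)/negPf.
have color a b : adj H a b -> c a == i -> b \notin A.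
  move=> ab /eqP ca; rewrite !inE negb_or.
  have := c_proper _ _ ab; rewrite ca eq_sym => -> /=.
  by apply/negP => /forallP/(_ a); rewrite adj_sym ab.
exists A; split.
- move=> a; rewrite inE => /orP[/eqP/c_close //|iso] e f g eE _ _ ae.
  by have [x _] := edge_cover eE ae; rewrite iso_adj.
- move=> a a' aA a'A; move: aA; rewrite inE => /orP[ca|/iso_adj->//].
  by apply: contraL a'A => /color; apply.
- move=> e eE; have /eqP/cards2P[x [y [xy exy]]] := edge_card2 eE.
  have xyE : adj H x y by rewrite /adj -exy.
  have [cx|ncx] := boolP (c x == i).
    by exists x, y; rewrite inE cx (color _ _ xyE).
  have cy : c y == i.
    by have := c_proper _ _ xyE; move: ncx; case: (c x) (c y) (i) => -[] [].
  exists y, x; rewrite inE cy setUC exy (color y)//.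
  by rewrite adj_sym.
move=> b; rewrite inE negb_or => /andP[cb].
rewrite negb_forall => /existsP[a]; rewrite negbK => ba.
exists a; last by rewrite adj_sym.
rewrite inE; apply/orP; left.
by have := c_proper _ _ ba; move: cb; case: (c a) (c b) (i) => -[] [].
Qed.

(** The stars of an independent set of close vertices are disjoint intervals of the edge-order, so
    comparing their last edges compares all their edges. *)
Lemma close_order (U : finType) (H : eograph U) (A : {set U}) :
    {in A, forall a, close_vertex H a} -> {in A &, forall a a', ~~ adj H a a'} ->
  exists pos : U -> nat,
    injective pos /\
      (forall a a' e f, a \in A -> a' \in A -> a != a' ->
          e \in edges H -> f \in edges H -> a \in e -> a' \in f ->
          edge_rank H e < edge_rank H f -> pos a < pos a').
Proof.
move=> A_close A_indep.
pose key a := \max_(e in [set e in edges H | a \in e]) edge_rank H e.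
pose s := sort (relpre key leq) (enum U).
have s_mem u : u \in s by rewrite mem_sort mem_enum.
(* The index in the sorted list, unlike [key] itself, also separates vertices with equal keys. *)
exists (fun u => index u s); split=> [u v|a a' e f aA a'A naa' eE fE ae a'f ef].
- by move=> /(congr1 (nth u s)); rewrite !nth_index.
have : key a < key a'.
  apply: (@leq_trans (edge_rank H f)); last first.
    by apply: (@leq_bigmax_cond _ _ (edge_rank H)); rewrite inE fE.
  have [|g] := @eq_bigmax_cond _ (mem [set e in edges H | a \in e])
    (edge_rank H).
    by apply/card_gt0P; exists e; rewrite inE eE.
  rewrite inE => /andP[gE ag]; rewrite /key => ->; rewrite ltnNge; apply/negP => fg.
  (* Otherwise [f] lies between the edges [e] and [g] at [a]; closeness puts [a] on [f], so [f]
     joins [a] to [a'] inside [A]. *)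
  have af : a \in f.
    by apply: (A_close a aA e f g) => //; rewrite edge_leE// ltnW.
  have [x fax ax] := edge_cover fE af; move: a'f.
  rewrite fax !inE eq_sym (negPf naa') /= => /eqP a'x.
  by have := A_indep a a' aA a'A; rewrite a'x ax.
apply: contraLR; rewrite -!leqNgt => pos_le.
have tr : transitive (relpre key leq) by move=> ? ? ?; apply: leq_trans.
have srt : sorted (relpre key leq) s.
  by apply: sort_sorted => u v; apply: leq_total.
have rfl : reflexive (relpre key leq) by move=> ? /=.
have := sorted_leq_nth tr rfl a srt (index a' s) (index a s).
by rewrite !inE !index_mem !s_mem !nth_index// => /(_ isT isT pos_le).
Qed.

(** * Many rows force a copy of [H] *)

(** [Es u] is the window reserved for the star of [u]. In the constant, the power is the loss in the
    colour coding with colours [option U], and the rest is the number of rows that [rows_embed] asks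
    for, with [#|A|] bounded by [#|U|]. *)
Lemma window_degree_bound (U V : finType) (H : eograph U) (G : eograph V)
    (A : {set U}) (pos : U -> nat) (X Y : {set V}) (Es : U -> {set {set V}})
    (d : V -> nat) :
    is_forest H ->
    {in A &, forall a a', ~~ adj H a a'} ->
    (forall e, e \in edges H ->
       exists a b, [/\ a \in A, b \notin A & e = [set a; b]]) ->
    (forall b, b \notin A -> exists2 a, a \in A & adj H a b) ->
    injective pos ->
    (forall a a' e f, a \in A -> a' \in A -> a != a' ->
       e \in edges H -> f \in edges H -> a \in e -> a' \in f ->
       edge_rank H e < edge_rank H f -> pos a < pos a') ->
    avoids G H ->
    (forall u e, e \in Es u -> e \in edges G /\ e \subset X) ->
    (forall u u' e f, pos u < pos u' -> e \in Es u -> f \in Es u' ->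
       edge_rank G e < edge_rank G f) ->
    (forall v u, v \in Y -> d v <= #|[set e in Es u | v \in e]|) ->
  \sum_(v in Y) d v
    <= #|U|.+1 ^ #|U|.+1 * (#|U| * (4 * #|U|)) * #|X|.
Proof.
move=> H_forest A_indep A_edge A_dom pos_inj pos_mono G_avoid EsG Es_mono d_deg.
rewrite leqNgt; apply: contra G_avoid => many.
(* A row is a centre [v] in [Y] with an index [i < d v]; it provides the [i]-th
   edge at [v] of every window. *)
pose T := {v : V & 'I_(d v)}.
pose y (r : T) := tag r.
pose star u v := enum [set e in Es u | v \in e].
pose edge u (r : T) := nth set0 (star u (tag r)) (tagged r).
(* The far end of the edge; the default is never reached for rows in [R]. *)
pose x u r := odflt (y r) [pick z | edge u r == [set y r; z]].
pose R := [set r : T | y r \in Y].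
have R_card : #|R| = \sum_(v in Y) d v.
  rewrite -sum1_card; under [RHS]eq_bigr => v _ do rewrite -[d v]card_ord -sum1_card.
  rewrite sig_big_dep /=; apply: eq_bigl => r.
  by rewrite !inE andbT.
have idx_lt u r : r \in R -> tagged r < size (star u (y r)).
  rewrite inE -cardE => /(d_deg _ u); apply: leq_trans; exact: ltn_ord.
have edge_mem u r : r \in R -> edge u r \in Es u /\ y r \in edge u r.
  by move/(idx_lt u)/(mem_nth set0); rewrite mem_enum inE => /andP.
have edgeG u r : r \in R -> edge u r \in edges G.
  by move/(edge_mem u) => [/EsG[]].
have edgeE u r : r \in R -> edge u r = [set y r; x u r].
  move=> rR; have [_ yr] := edge_mem u r rR; have eG := edgeG u r rR.
  have [z ez _] := edge_cover eG yr; rewrite /x.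
  by case: pickP => [z' /eqP //|/(_ z)/eqP].
have x_neq_y u r : r \in R -> x u r != y r.
  move=> rR; have := edgeG u r rR; rewrite edgeE// => /adj_neq.
  by rewrite eq_sym.
have edge_window u u' r : r \in R -> edge u r = edge u' r -> u = u'.
  move=> rR E; apply: pos_inj; have [eu _] := edge_mem u r rR.
  have [eu' _] := edge_mem u' r rR.
  case: (ltngtP (pos u) (pos u')) => // lt.
    by have := Es_mono _ _ _ _ lt eu eu'; rewrite E ltnn.
  by have := Es_mono _ _ _ _ lt eu' eu; rewrite E ltnn.
have row_inj u r r' : r \in R -> r' \in R -> x u r = x u r' -> y r = y r' ->
    r = r'.
  move=> rR r'R xx yy; have : edge u r = edge u r' by rewrite !edgeE// xx yy.
  case: r r' rR r'R yy {xx} => [v i] [v' i'] rR r'R /= vv'.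
  case: v' / vv' i' r'R => i' r'R /eqP.
  have := idx_lt u _ rR; have := idx_lt u _ r'R; rewrite /edge /= => l' l.
  by rewrite nth_uniq ?enum_uniq // => /eqP/val_inj->.
(* Colour [None] is meant for the centre, [Some u] for the far end in window [u]. *)
pose p r (j : option U) := if j is Some u then x u r else y r.
have p_inj : {in R, forall r, injective (p r)}.
  move=> r rR [u|] [u'|] //= E.
  - by congr Some; apply: (edge_window _ _ r rR); rewrite !edgeE// E.
  - by have := x_neq_y u r rR; rewrite E eqxx.
  - by have := x_neq_y u' r rR; rewrite E eqxx.
have [chi] := rainbow_coloring None p_inj; rewrite card_option R_card => few.
pose R1 := [set r in R | [forall j, chi (p r j) == j]]; rewrite -/R1 in few.
have R1R r : r \in R1 -> r \in R by rewrite inE => /andP[].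
have chix u r : r \in R1 -> chi (x u r) = Some u.
  by rewrite inE => /andP[_ /forallP/(_ (Some u))/eqP].
have chiy r : r \in R1 -> chi (y r) = None.
  by rewrite inE => /andP[_ /forallP/(_ None)/eqP].
have R1_big : #|A| * (4 * #|U| * #|X|) < #|R1|.
  have := leq_trans many few; rewrite -mulnA ltn_pmul2l ?expn_gt0//.
  apply: leq_ltn_trans; rewrite mulnA leq_mul2r; apply/orP; right.
  by rewrite leq_mul2r max_card orbT.
have [||||||rho [rhoR rho_inj rho_x rho_t]] := @rows_embed U U V T (adj H)
    (fun a b => edge_rank H [set a; b]) x y (fun u r => edge_rank G (edge u r))
    X A R1.
- by move=> S' _; apply: forest_elimination.
- move=> a b b' ab ab' /edge_rank_inj E; apply: (set2_inj (adj_neq ab)).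
  exact: E.
- move=> u r /R1R rR; have [/EsG[_ /subsetP eX] _] := edge_mem u r rR.
  by apply: eX; rewrite edgeE// !inE eqxx orbT.
- by move=> u r r' /R1R rR /R1R r'R; apply: row_inj.
- move=> u r r' /R1R rR /R1R r'R xx.
  move/(edge_rank_inj (edgeG u r rR) (edgeG u r' r'R)) => E.
  apply: (row_inj u) => //; apply: (@set2_inj _ (x u r)).
    exact: x_neq_y.
  by rewrite setUC -edgeE// E edgeE// xx setUC.
- exact: R1_big.
(* All neighbours of [a] have rows with the same far end in window [a], so any of them defines the
   image. An isolated [a] takes the far end from the row of [a], which still has colour [Some a]. *)
pose phi := [ffun u => if u \in A then
  x u (rho (odflt u [pick b | adj H u b])) else y (rho u)].
have phiB b : b \notin A -> phi b = y (rho b) by rewrite ffunE => /negPf->.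
have phiA a b : a \in A -> adj H a b -> phi a = x a (rho b).
  move=> aA ab; rewrite ffunE aA; case: pickP => [b' ab'|/(_ b)]; last first.
    by rewrite ab.
  exact: rho_x.
have chi_phi u : chi (phi u) = if u \in A then Some u else None.
  by rewrite ffunE; case: ifP => _; [apply: chix|apply: chiy].
have phi_edge a b : a \in A -> b \notin A -> adj H a b ->
    phi @: [set a; b] = edge a (rho b).
  move=> aA bA ab; rewrite imsetU !imset_set1 (phiA a b)// phiB// edgeE ?R1R//.
  by rewrite setUC.
have phi_G e : e \in edges H -> phi @: e \in edges G.
  move=> eH; have [a [b [aA bA eab]]] := A_edge e eH.
  by rewrite eab phi_edge ?edgeG ?R1R // /adj -eab.
have phi_mono e f : e \in edges H -> f \in edges H ->
    edge_rank H e < edge_rank H f ->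
    edge_rank G (phi @: e) < edge_rank G (phi @: f).
  move=> eH fH; have [a [b [aA bA eab]]] := A_edge e eH.
  have [a' [b' [a'A b'A fab]]] := A_edge f fH.
  have ab : adj H a b by rewrite /adj -eab.
  have ab' : adj H a' b' by rewrite /adj -fab.
  rewrite eab fab !phi_edge//.
  have [aa'|naa'] := eqVneq a a'; first by rewrite -aa' in ab' *; apply: rho_t.
  rewrite -eab -fab => lt; have lt_pos : pos a < pos a'.
    by apply: (pos_mono a a' e f) => //; rewrite ?eab ?fab !inE eqxx.
  by apply: (Es_mono _ _ _ _ lt_pos); apply: (edge_mem _ _ (R1R _ (rhoR _))).1.
apply/existsP; exists phi; apply/and3P; split.
(* Colours identify the members of [A] and separate them from the rest; outside [A], injectivity
   comes from [rho_inj], whose domain condition is [A_dom]. *)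
- apply/injectiveP => u u' E; have := congr1 chi E; rewrite !chi_phi.
  case: ifP => [_|/negbT uA]; case: ifP => [_ [//]|/negbT u'A] // _.
  have [a aA au] := A_dom u uA; have [a' a'A au'] := A_dom u' u'A.
  apply: rho_inj; rewrite ?inE /=.
  + by apply/exists_inP; exists a.
  + by apply/exists_inP; exists a'.
  by rewrite -!phiB.
- by apply/forall_inP => e; apply: phi_G.
apply/forall_inP => e eH; apply/forall_inP => f fH.
rewrite !edge_leE ?phi_G//; apply/eqP.
case: (ltngtP (edge_rank H e)) => [lt|lt|E].
- by rewrite ltnW// phi_mono.
- by rewrite leqNgt phi_mono.
by rewrite (edge_rank_inj eH fH E) leqnn.
Qed.

(** * Heavy windows, rich and poor vertices *)

Lemma leq_ceil_divn (m n : nat) : 0 < m -> n <= m * ((n + m.-1) %/ m).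
Proof.
move=> m0; have := ltn_ceil (n + m.-1) m0; rewrite mulSn mulnC.
by move: (m * _) => w; lia.
Qed.

Lemma ceil_divn_leq (m n q : nat) :
  0 < m -> n <= m * q -> (n + m.-1) %/ m <= q.
Proof.
move=> m0; rewrite -[_ <= q]ltnS ltn_divLR// mulSn [q * m]mulnC.
by move: (m * q) => w; lia.
Qed.

Definition degree (V : finType) (E : {set {set V}}) (v : V) : nat :=
  #|[set e in E | v \in e]|.

Definition window (V : finType) (M : nat) (E : {set {set V}})
    (win : {set V} -> 'I_M) (j : 'I_M) : {set {set V}} :=
  [set e in E | win e == j].

Definition heavy (V : finType) (M : nat) (E : {set {set V}})
    (win : {set V} -> 'I_M) (v : V) : {set 'I_M} :=
  [set j | degree E v <= 4 * M * degree (window E win j) v].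

(** The vertex set with which the recursion enters window [j]. *)
Definition poor (V : finType) (M k : nat) (E : {set {set V}}) (X : {set V})
    (win : {set V} -> 'I_M) (j : 'I_M) : {set V} :=
  [set v in X | (#|heavy E win v| < k) && (j \in heavy E win v)].

(** The conclusion of [window_degree_bound] for a fixed [G]: the form in which the avoidance of [H]
    enters the counting below. *)
Definition window_bounded (U V : finType) (G : eograph V) (pos : U -> nat)
    (C : nat) : Prop :=
  forall (X Y : {set V}) (Es : U -> {set {set V}}) (d : V -> nat),
    (forall u e, e \in Es u -> e \in edges G /\ e \subset X) ->
    (forall u u' e f, pos u < pos u' -> e \in Es u -> f \in Es u' ->
       edge_rank G e < edge_rank G f) ->
    (forall v u, v \in Y -> d v <= degree (Es u) v) ->
    \sum_(v in Y) d v <= C * #|X|.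

(** There are at most [M ^ #|U|] increasing assignments of windows to the vertices of [H]. Every
    rich vertex has one that uses only its heavy windows, and the window bound applies to each
    assignment. *)
Lemma rich_degree_bound (U V : finType) (G : eograph V) (pos : U -> nat)
    (C M : nat) (E : {set {set V}}) (X : {set V}) (win : {set V} -> 'I_M) :
    window_bounded G pos C -> injective pos -> 0 < M ->
    E \subset edges G -> {in E, forall e : {set V}, e \subset X} ->
    {in E &, forall e f, win e < win f -> edge_rank G e < edge_rank G f} ->
  \sum_(v in X | #|U| <= #|heavy E win v|) degree E v
    <= 4 * M * (M ^ #|U| * (C * #|X|)).
Proof.
move=> bounded pos_inj M0 /subsetP EG EX win_mono.
pose good (sg : {ffun U -> 'I_M}) v := [forall u, sg u \in heavy E win v].
pose mono (sg : {ffun U -> 'I_M}) :=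
  [forall u, forall u', (pos u < pos u') ==> (sg u < sg u')].
have mono_bound sg : mono sg ->
    \sum_(v in X | good sg v) degree E v <= 4 * M * (C * #|X|).
  (* Rounding up: a heavy window still holds [d v] edges at [v], and [4 * M * d v] is at least the
     degree. *)
  move=> /forallP sg_mono; pose d v := (degree E v + (4 * M).-1) %/ (4 * M).
  have M4 : 0 < 4 * M by rewrite muln_gt0.
  apply: leq_trans (_ : \sum_(v in [set v in X | good sg v]) 4 * M * d v <= _).
    have -> : \sum_(v in X | good sg v) degree E v
        = \sum_(v in [set v in X | good sg v]) degree E v.
      by apply: eq_bigl => v; rewrite inE.
    by apply: leq_sum => v _; apply: leq_ceil_divn.
  rewrite -big_distrr leq_mul2l /=; apply/orP; right.
  apply: (bounded _ _ (fun u => window E win (sg u))) => [u e|u u' e f|v u].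
  - by rewrite inE => /andP[eE _]; split; [apply: EG|apply: EX].
  - move=> lt; rewrite !inE => /andP[eE /eqP we] /andP[fE /eqP wf].
    apply: win_mono => //; rewrite we wf.
    by have /forallP/(_ u')/implyP := sg_mono u; apply.
  rewrite inE => /andP[_ /forallP/(_ u)]; rewrite inE.
  exact: ceil_divn_leq.
have -> : 4 * M * (M ^ #|U| * (C * #|X|))
    = \sum_(sg : {ffun U -> 'I_M}) 4 * M * (C * #|X|).
  by rewrite sum_nat_const card_ffun card_ord mulnCA.
apply: leq_trans (_ : \sum_(sg : {ffun U -> 'I_M} | mono sg)
  \sum_(v in X | good sg v) degree E v <= _); last first.
  rewrite big_mkcond; apply: leq_sum => sg _.
  by case: ifP => // /mono_bound.
rewrite (exchange_big_dep (mem X)) /= => [|sg v _ /andP[]//].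
rewrite big_mkcondr; apply: leq_sum => v vX; case: ifP => // rich.
(* With at least [#|U|] heavy windows, [v] is counted for the assignment [f]. *)
have [||f [f_heavy f_mono]] := @increasing_selection U 'I_M setT (heavy E win v)
    pos val (Ordinal M0).
- by move=> i j _ _ /val_inj.
- by rewrite cardsT.
rewrite (bigD1 (finfun f)) ?leq_addr//= vX /=; apply/andP; split.
  apply/forallP => u; apply/forallP => u'; apply/implyP => lt.
  by rewrite !ffunE; apply: f_mono.
by apply/forallP => u; rewrite ffunE; apply: f_heavy.
Qed.

Lemma sum_degree (V : finType) (E : {set {set V}}) (X : {set V}) :
  {in E, forall e : {set V}, #|e| = 2} -> \sum_(v in X) degree E v <= 2 * #|E|.
Proof.
move=> E2; rewrite mulnC -sum_nat_const.
have -> : \sum_(v in X) degree E v = \sum_(v in X) \sum_(e in E) (v \in e).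
  apply: eq_bigr => v _; rewrite /degree -sum1dep_card big_mkcondr.
  by apply: eq_bigr => e _; case: (v \in e).
rewrite exchange_big /=; apply: leq_sum => e /E2 <-.
rewrite -sum1_card [leqRHS]big_mkcond [leqLHS]big_mkcond /=.
by apply: leq_sum => v _; case: (v \in X); case: (v \in e).
Qed.

(** Each of the at most [M] light windows holds less than a fraction [1/(4M)] of the degree, so
    together they hold at most a quarter. *)
Lemma sum_window_degree (V : finType) (M : nat) (E : {set {set V}})
    (win : {set V} -> 'I_M) (v : V) :
  4 * \sum_(j | j \notin heavy E win v) degree (window E win j) v <= degree E v.
Proof.
have [M0|M0] := posnP M.
  by rewrite big1 ?muln0// => j; have := ltn_ord j; rewrite {2}M0.
rewrite -(leq_pmul2l M0) mulnA [M * 4]mulnC big_distrr /=.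
apply: leq_trans (_ : \sum_(j : 'I_M) degree E v <= _); last first.
  by rewrite sum_nat_const card_ord.
rewrite big_mkcond; apply: leq_sum => j _; case: ifP => //.
by rewrite inE -ltnNge => /ltnW.
Qed.

(** An edge that is not inside the poor set of its window is charged to an end that is rich or for
    which this window is light. Charges to vertices that are not rich sum to at most a quarter of
    the total degree, that is, to at most [#|E| / 2], which the left side absorbs. *)
Lemma window_decomposition (V : finType) (M k : nat) (E : {set {set V}})
    (X : {set V}) (win : {set V} -> 'I_M) :
    {in E, forall e : {set V}, #|e| = 2} -> {in E, forall e : {set V}, e \subset X} ->
  #|E| <= 2 * \sum_(j : 'I_M) #|[set e in window E win j | e \subset poor k E X win j]|
    + 2 * \sum_(v in X | k <= #|heavy E win v|) degree E v.
Proof.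
move=> E2 EX; set SE := (\sum_j _)%N; set SR := (\sum_(v in X | _) _)%N.
pose good := [set e in E | e \subset poor k E X win (win e)].
have good_card : #|good| <= SE.
  apply: leq_trans (_ : \sum_(j in setT)
      #|[set e in window E win j | e \subset poor k E X win j]| <= _).
    apply: card_cover_le => e; rewrite inE => /andP[eE ep].
    by exists (win e); rewrite // !inE eE eqxx ep.
  by rewrite leq_eqVlt; apply/orP; left; apply/eqP/eq_bigl => j; rewrite inE.
pose rich v := k <= #|heavy E win v|.
pose light v := \sum_(j | j \notin heavy E win v) degree (window E win j) v.
pose bad v := [set e in E | (v \in e) && (rich v || (win e \notin heavy E win v))].
have bad_card v : 4 * #|bad v| <= (if rich v then 4 * degree E v else 0) + degree E v.
  have [rv|nrv] := boolP (rich v).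
    have : #|bad v| <= degree E v.
      apply/subset_leq_card/subsetP => e; rewrite !inE.
      by move=> /and3P[-> ->].
    lia.
  rewrite add0n; apply: leq_trans (sum_window_degree _ win _).
  rewrite leq_mul2l /=.
  have -> : \sum_(j | j \notin heavy E win v) degree (window E win j) v
      = \sum_(j in [set j | j \notin heavy E win v]) degree (window E win j) v.
    by apply: eq_bigl => j; rewrite inE.
  apply: card_cover_le => e; rewrite inE (negPf nrv) /= => /and3P[eE ve wh].
  by exists (win e); rewrite !inE ?eE ?eqxx ?ve//; rewrite inE in wh.
have Ebad : #|E :\: good| <= \sum_(v in X) #|bad v|.
  apply: card_cover_le => e; rewrite !inE => /andP[ngood eE].
  move: ngood; rewrite eE /= => /subsetPn[v ve]; rewrite !inE.
  have vX : v \in X by apply: (subsetP (EX e eE)).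
  rewrite vX /= negb_and -leqNgt => bv; exists v => //.
  by rewrite !inE eE ve.
have : 4 * \sum_(v in X) #|bad v| <= 4 * SR + 2 * #|E|.
  apply: leq_trans (_ : 4 * SR + \sum_(v in X) degree E v <= _); last first.
    by rewrite leq_add2l; apply: sum_degree.
  rewrite !big_distrr /= [X in _ <= X + _]big_mkcondr /= -big_split /=.
  by apply: leq_sum => v _; apply: bad_card.
have : #|E| = #|good| + #|E :\: good|.
  rewrite -(cardsID good E); congr (_ + _); apply: eq_card => e.
  by rewrite !inE; case: (e \in E).
lia.
Qed.

(** A vertex is counted once for each of its heavy windows, and only if these are fewer than [k]. *)
Lemma sum_poor (V : finType) (M k : nat) (E : {set {set V}})
    (X : {set V}) (win : {set V} -> 'I_M) :
  \sum_(j : 'I_M) #|poor k E X win j| <= k * #|X|.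
Proof.
rewrite mulnC -sum_nat_const.
pose few v := #|heavy E win v| < k.
have -> : \sum_(j : 'I_M) #|poor k E X win j|
    = \sum_(j : 'I_M) \sum_(v in X) (few v && (j \in heavy E win v)).
  apply: eq_bigr => j _; rewrite /poor -sum1dep_card big_mkcondr.
  by apply: eq_bigr => v _; case: (_ && _).
rewrite exchange_big; apply: leq_sum => v _ /=.
have [lt|_] := boolP (few v); last by rewrite big1.
apply: leq_trans (ltnW lt); rewrite -sum1_card [leqRHS]big_mkcond.
by apply: leq_sum => j _; case: (j \in _).
Qed.

(** * The recursion into windows *)

(** Each level of the recursion divides the bound on the number of edges by [M] and costs a factor
    [2 * #|U| + 2]: [2 * #|U|] for the poor sets in all windows, 2 for the rich vertices. *)
Lemma edge_bound (U V : finType) (G : eograph V) (pos : U -> nat)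
    (C M L : nat) (E : {set {set V}}) (X : {set V}) :
    window_bounded G pos C -> injective pos -> 0 < C -> 0 < M ->
    E \subset edges G -> {in E, forall e : {set V}, e \subset X} ->
    #|E| <= M ^ L ->
  #|E| <= (2 * #|U| + 2) ^ L * (4 * M * (M ^ #|U| * C)) * #|X|.
Proof.
move=> bounded pos_inj C0 M0; set K := 4 * M * (M ^ #|U| * C).
have K0 : 0 < K by rewrite !muln_gt0 M0 expn_gt0 M0.
elim: L E X => [|L IH] E X EG EX EM.
  have [->|/set0Pn[e eE]] := eqVneq E set0; first by rewrite cards0.
  apply: leq_trans EM _; rewrite !expn0 mul1n muln_gt0 K0 card_gt0 /=.
  apply/set0Pn; have := edge_card2 (subsetP EG e eE).
  move=> e2; have /card_gt0P[v ve] : 0 < #|e| by rewrite e2.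
  by exists v; apply: (subsetP (EX e eE)).
pose rk e := #|[set f in E | edge_rank G f < edge_rank G e]|.
have rk_lt e : e \in E -> rk e < #|E|.
  move=> eE; apply: proper_card; apply/properP; split.
    by apply/subsetP => f; rewrite inE => /andP[].
  by exists e; rewrite // !inE ltnn andbF.
have rk_mono e f : edge_rank G e <= edge_rank G f -> rk e <= rk f.
  move=> le; apply/subset_leq_card/subsetP => g; rewrite !inE.
  by case/andP => -> /leq_trans; apply.
have rk_smono e f : e \in E -> edge_rank G e < edge_rank G f -> rk e < rk f.
  move=> eE lt; apply: proper_card; apply/properP; split.
    by apply/subsetP => g; rewrite !inE => /andP[-> /ltn_trans]; apply.
  by exists e; rewrite !inE eE ?ltnn.
have ML0 : 0 < M ^ L by rewrite expn_gt0 M0.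
(* Blocks of [M ^ L] consecutive edges of [E]; the default index is taken only outside [E]. *)
pose win e : 'I_M := insubd (Ordinal M0) (rk e %/ M ^ L).
have winE e : e \in E -> val (win e) = rk e %/ M ^ L.
  move=> eE; rewrite val_insubd ltn_divLR// -expnS.
  by rewrite (leq_trans (rk_lt e eE) EM).
have win_mono : {in E &, forall e f, win e < win f -> edge_rank G e < edge_rank G f}.
  move=> e f eE fE /=; have -> := winE e eE; have -> := winE f fE.
  by rewrite !ltnNge; apply: contra => /rk_mono /leq_div2r; apply.
have win_card j : #|window E win j| <= M ^ L.
  apply: (@card_nat_range _ _ rk (j * M ^ L)).
    move=> e f; rewrite !inE => /andP[eE _] /andP[fE _] ef.
    apply: (edge_rank_inj (subsetP EG e eE) (subsetP EG f fE)).
    case: (ltngtP (edge_rank G e) (edge_rank G f)) => // lt.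
      by have := rk_smono _ _ eE lt; rewrite ef ltnn.
    by have := rk_smono _ _ fE lt; rewrite ef ltnn.
  move=> e; rewrite inE => /andP[eE /eqP <-]; rewrite (winE e eE).
  by rewrite leq_divM /= -mulSnr ltn_ceil.
apply: leq_trans (@window_decomposition _ _ #|U| E X win _ EX) _.
  by move=> e eE; apply: edge_card2; apply: (subsetP EG).
rewrite expnS; set W := (2 * #|U| + 2) ^ L * K * #|X|.
rewrite (_ : _ * _ * K * _ = (2 * #|U| + 2) * W); last by rewrite /W !mulnA.
have rich : 2 * \sum_(v in X | #|U| <= #|heavy E win v|) degree E v <= 2 * W.
  rewrite leq_mul2l /=; apply: leq_trans (rich_degree_bound _ _ _ EG EX win_mono) _;
    [exact: bounded|by []|by []|].
  rewrite (_ : 4 * M * _ = K * #|X|); last by rewrite /K !mulnA.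
  by rewrite /W -[_ * K * _]mulnA leq_pmull// expn_gt0 addn2.
rewrite mulnDl leq_add// -[2 * #|U| * W]mulnA leq_mul2l /=.
apply: leq_trans (_ : \sum_(j : 'I_M) (2 * #|U| + 2) ^ L * K *
  #|poor #|U| E X win j| <= _).
  apply: leq_sum => j _; apply: IH.
  - apply: subset_trans EG; apply/subsetP => e.
    by rewrite inE => /andP[]; rewrite inE => /andP[].
  - by move=> e; rewrite inE => /andP[].
  apply: leq_trans (win_card j); apply/subset_leq_card/subsetP => e.
  by rewrite inE => /andP[].
by rewrite -big_distrr /= /W [leqRHS]mulnCA leq_mul2l sum_poor orbT.
Qed.

(** For [M = 2 ^ s] the cost of the rich vertices becomes an [s]-th power, like the cost of a
    recursion of depth [s]. *)
Lemma window_factor_leq (k C s : nat) : 0 < C -> 0 < s ->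
  4 * 2 ^ s * ((2 ^ s) ^ k * C) <= (4 * (2 * (2 ^ k * C))) ^ s.
Proof.
move=> C0 s0; have pow m : 0 < m -> m <= m ^ s.
  by move=> m0; rewrite -[leqLHS]expn1 leq_pexp2l.
rewrite !expnMn -!mulnA leq_mul ?pow// leq_mul2l; apply/orP; right.
by rewrite -!expnM [s * k]mulnC leq_mul ?pow.
Qed.

Lemma card_edges_leq (V : finType) (G : eograph V) :
  #|edges G| <= #|V| ^ 2.
Proof.
have sub : edges G \subset [set [set p.1; p.2] | p in {: V * V}].
  apply/subsetP => e /edge_card2/eqP/cards2P[a [b [_ ->]]].
  by apply/imsetP; exists (a, b).
apply: leq_trans (subset_leq_card sub) _.
by apply: leq_trans (leq_imset_card _ _) _; rewrite card_prod mulnn.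
Qed.

Lemma ex_lt_leq (U : finType) (H : eograph U) :
    edges H != set0 -> is_forest H -> order_chromatic2 H ->
  exists B : nat, forall n s : nat, 0 < s -> n ^ 2 <= 2 ^ (s * s) ->
    ex_lt n H <= n * B ^ s.
Proof.
move=> /set0Pn[e0 e0H] H_forest /close_class[A [A_close A_indep A_edge A_dom]].
have [pos [pos_inj pos_mono]] := close_order A_close A_indep.
have U0 : 0 < #|U|.
  by have [a _] := A_edge e0 e0H; apply/card_gt0P; exists a.
pose C := #|U|.+1 ^ #|U|.+1 * (#|U| * (4 * #|U|)).
have C0 : 0 < C by rewrite !muln_gt0 expn_gt0 U0.
exists ((2 * #|U| + 2) * (4 * (2 * (2 ^ #|U| * C)))) => n s s0 ns.
apply/bigmax_leqP => G G_avoid.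
have bounded : window_bounded G pos C.
  move=> X Y Es d; exact: (window_degree_bound H_forest A_indep A_edge A_dom
    pos_inj pos_mono G_avoid).
(* With [M = 2 ^ s], depth [s] suffices, since [G] has at most [n ^ 2] edges. *)
have Elarge : #|edges G| <= (2 ^ s) ^ s.
  rewrite -expnM; apply: leq_trans ns.
  by apply: leq_trans (card_edges_leq G) _; rewrite card_ord.
have := edge_bound bounded pos_inj C0 _ (subxx _) _ Elarge.
move=> /(_ [set: 'I_n]); rewrite expn_gt0 cardsT card_ord => /(_ isT) bd.
apply: leq_trans (bd (fun e _ => subsetT e)) _.
rewrite mulnC leq_mul2l; apply/orP; right.
by rewrite expnMn leq_mul2l window_factor_leq ?orbT.
Qed.

(** * The choice of [s] and the final estimate *)

Import Order.TTheory GRing.Theory Num.Theory.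
Local Open Scope ring_scope.

Lemma powR2_log2 (R : realType) (x : R) : 0 < x -> 2 `^ log2 x = x.
Proof.
move=> x0; rewrite /powR pnatr_eq0 /= /log2 divfK ?lnK//.
by rewrite gt_eqF// ln_gt0// ltr1n.
Qed.
Theorem theorem2 (R : realType) (U : finType) (H : eograph U)
    (H_edge : edges H != set0) (H_forest : is_forest H)
    (H_chi2 : order_chromatic2 H) :
  exists C : R, forall n : nat, (2 <= n)%N ->
    (ex_lt n H)%:R <= n%:R * 2 `^ (C * Num.sqrt (log2 (n%:R : R))).
Proof.
have [B ex_le] := ex_lt_leq H_edge H_forest H_chi2.
(* [B ^ s] is at most [2 ^ (B * s)], and [s <= 2 * r + 1 <= 3 * r] because [n >= 2] gives
   [r >= 1]. *)
exists (3 * B%:R) => n n2; set r := Num.sqrt _.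
have ln2 : (0 : R) < ln 2 by rewrite ln_gt0// ltr1n.
have log_ge1 : 1 <= log2 n%:R :> R.
  rewrite /log2 ler_pdivlMr// mul1r ler_ln ?posrE ?ltr0n ?ler_nat//.
  exact: ltn_trans n2.
have r2 : r ^+ 2 = log2 n%:R by rewrite sqr_sqrtr// (le_trans ler01).
have r1 : 1 <= r by rewrite -sqrtr1 ler_wsqrtr.
(* From [s > 2 * r] follows [s * s >= 2 * r ^+ 2], where the right side is the logarithm of
   [n ^ 2]. *)
pose s := (Num.truncn (2 * r)).+1.
have /andP[s_le s_gt] : (Num.truncn (2 * r))%:R <= 2 * r < s%:R.
  by apply: truncn_itv; rewrite mulr_ge0// (le_trans ler01).
have n_pos : (0 : R) < n%:R by rewrite ltr0n (ltn_trans _ n2).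
have n_sq : (n ^ 2 <= 2 ^ (s * s))%N.
  rewrite -(ler_nat R) !natrX -(powR_mulrn (s * s))//.
  rewrite -{1}(powR2_log2 n_pos) -powR_mulrn ?powR_ge0// -powRrM.
  rewrite ler_powR ?ler1n// -r2 natrM.
  by move: s_gt r1; move: (s%:R : R) => t; nra.
apply: le_trans (_ : (n * B ^ s)%:R <= _).
  by rewrite ler_nat; apply: ex_le.
rewrite natrM ler_wpM2l//; apply: le_trans (_ : (2 ^ (B * s))%:R <= _).
  by rewrite ler_nat expnM leq_exp2r// ltnW// ltn_expl.
rewrite natrX -powR_mulrn// ler_powR ?ler1n// natrM -mulrA mulrCA ler_wpM2l//.
have : s%:R <= 2 * r + 1 by rewrite /s -[leLHS]natr1 lerD2r.
by move: (s%:R : R) => t; lra.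
Qed.
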